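(* Let $\mathcal{H}$ be a real Hilbert space, $A:\mathcal{H}\rightrightarrows\mathcal{H}$ a maximally monotone operator, $D:\mathcal{H}\to\mathcal{H}$ a monotone and $\eta^{-1}$-Lipschitz continuous operator with $\eta>0$, and $B:\mathcal{H}\to\mathcal{H}$ a monotone and $\mu^{-1}$-Lipschitz continuous operator with $\mu>0$, and assume that $M:=\operatorname{zer}B\neq\emptyset$. Let $(\lambda_n)_{n\ge1}$, $(\beta_n)_{n\ge1}$, $(\alpha_n)_{n\ge1}$ be sequences of positive real numbers. Let $x_0,x_1\in\mathcal{H}$ and, for every $n\ge1$, set $$p_n=J_{\lambda_nA}\big(x_n-\lambda_nDx_n-\lambda_n\beta_nBx_n+\alpha_n(x_n-x_{n-1})\big),$$ $$x_{n+1}=\lambda_n\beta_n(Bx_n-Bp_n)+\lambda_n(Dx_n-Dp_n)+p_n,$$ and $$z_n=\frac1{\tau_n}\sum_{k=1}^n\lambda_kx_k,\qquad \tau_n=\sum_{k=1}^n\lambda_k .$$ Assume that: (1) $A+N_M$ is maximally monotone and $\operatorname{zer}(A+D+N_M)\neq\emptyset$; (2) for every $p\in\operatorname{ran}N_M$, $$\sum_{n\ge1}\lambda_n\beta_n\left[\sup_{y\in M}\varphi_B\left(y,\frac{p}{\beta_n}\right)-\sigma_M\left(\frac{p}{\beta_n}\right)\right]<+\infty;$$ (3) $(\lambda_n)_{n\ge1}\in\ell^2\setminus\ell^1$; (4) $(\alpha_n)_{n\ge1}$ is nondecreasing and there exist $n_0\ge1$, $\alpha\ge0$ and $\sigma>0$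 such that for all $n\ge n_0$ $$0\le\alpha_n\le\alpha\quad\text{and}\quad 5\alpha+2\sigma+(1+4\alpha+2\sigma)\left(\frac{\lambda_n\beta_n}{\mu}+\frac{\lambda_n}{\eta}\right)^2\le1 .$$ Then the following statements hold: (i) $\sum_{n\ge0}\|x_{n+1}-x_n\|^2<+\infty$ and $\sum_{n\ge1}\|x_n-p_n\|^2<+\infty$; (ii) $(z_n)_{n\ge1}$ converges weakly to an element of $\operatorname{zer}(A+D+N_M)$ as $n\to+\infty$; (iii) if $A$ is $\gamma$-strongly monotone with $\gamma>0$, then $(x_n)_{n\ge0}$ and $(p_n)_{n\ge1}$ converge strongly to the unique element of $\operatorname{zer}(A+D+N_M)$ as $n\to+\infty$.
   Context: For a set-valued operator $T:\mathcal{H}\rightrightarrows\mathcal{H}$: $\operatorname{Gr}T=\{(x,u):u\in Tx\}$, $\operatorname{zer}T=\{x:0\in Tx\}$, $\operatorname{ran}T=\{u:\exists x,\ u\in Tx\}$. $T$ is monotone if $\langle x-y,u-v\rangle\ge0$ for all $(x,u),(y,v)\in\operatorname{Gr}T$; maximally monotone if it is monotone and its graph has no proper monotone extension in $\mathcal{H}\times\mathcal{H}$; $\gamma$-strongly monotone if $\langle x-y,u-v\rangle\ge\gamma\|x-y\|^2$ for all $(x,u),(y,v)\in\operatorname{Gr}T$. The resolvent of $T$ is $J_T=(\mathrm{Id}+T)^{-1}$ (single-valued and everywhere defined when $T$ is maximally monotone). For a nonempty convex set $M\subseteq\mathcal{H}$: the normal cone is $N_M(x)=\{u:\langle u,y-x\rangle\le0\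 \forall y\in M\}$ if $x\in M$ and $N_M(x)=\emptyset$ if $x\notin M$; the support function is $\sigma_M(u)=\sup_{y\in M}\langle y,u\rangle$. The Fitzpatrick function of a monotone operator $T$ is $\varphi_T:\mathcal{H}\times\mathcal{H}\to\overline{\mathbb{R}}$, $\varphi_T(x,u)=\sup_{(y,v)\in\operatorname{Gr}T}\{\langle x,v\rangle+\langle y,u\rangle-\langle y,v\rangle\}$. *)

(* Defs.v *)
From HB Require Import structures.
From mathcomp Require Import all_boot all_order all_algebra.
From mathcomp Require Import all_classical all_reals all_analysis.

Set Implicit Arguments.
Unset Strict Implicit.
Unset Printing Implicit Defensive.

Import Order.TTheory GRing.Theory Num.Theory.
Import numFieldNormedType.Exports.

Local Open Scope classical_set_scope.
Local Open Scope ring_scope.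

(* A real Hilbert space: a Banach space whose norm is induced by an inner
   product (a positive definite symmetric bilinear form). *)
Record hilbertType (R : realType) := HilbertType {
  hilbert_sort :> completeNormedModType R;
  inner : {dot hilbert_sort for idfun};
  inner_norm : forall x : hilbert_sort, inner x x = `|x| ^+ 2 }.

Notation "''[' x , y ]" := (inner _ x y) : ring_scope.

Section Operators.
Context {R : realType} {H : hilbertType R}.
Implicit Types (T S : H -> set H) (f : H -> H) (M : set H).

(* A set-valued operator is a function into sets; [op_single f] is the
   single-valued operator with value f x at x. *)
Definition op_single f : H -> set H := fun x => [set f x].

Definition gr T : set (H * H) := [set xu | T xu.1 xu.2].
Definition zer T : set H := [set x | T x 0].
Definition ran T : set H := [set u | exists x, T x u].

Definition op_add T S : H -> set H := fun x => [set u + v | u in T x & v in S x].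
Definition op_scale (c : R) T : H -> set H := fun x => [set c *: u | u in T x].
Definition op_inv T : H -> set H := fun u => [set x | T x u].

Definition monotone_op T :=
  forall x u y v, gr T (x, u) -> gr T (y, v) -> 0 <= '[x - y, u - v].

Definition maximally_monotone T :=
  monotone_op T /\ forall S, monotone_op S -> gr T `<=` gr S -> gr S = gr T.

Definition strongly_monotone (gamma : R) T :=
  forall x u y v, gr T (x, u) -> gr T (y, v) ->
    gamma * `|x - y| ^+ 2 <= '[x - y, u - v].

(* J_T = (Id + T)^-1, as a set-valued operator. *)
Definition resolvent T : H -> set H := op_inv (op_add (op_single id) T).

Definition normal_cone M : H -> set H :=
  fun x => [set u | M x /\ forall y, M y -> '[u, y - x] <= 0].

Definition support_fun M (u : H) : \bar R := ereal_sup [set ('[y, u])%:E | y in M].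

Definition fitzpatrick T (x u : H) : \bar R :=
  ereal_sup [set ('[x, yv.2] + '[yv.1, u] - '[yv.1, yv.2])%:E | yv in gr T].

Definition weak_cvg (z : nat -> H) (w : H) :=
  forall u, '[z n, u] @[n --> \oo] --> ('[w, u] : R).

End Operators.

(* Membership in l^q of a sequence indexed from 1; the value at 0 is ignored. *)
Definition in_ell {R : realType} (q : nat) (u : nat -> R) :=
  (\sum_(1 <= n <oo) (`|u n| ^+ q)%:E < +oo)%E.

Definition weight {R : realType} (lambda : nat -> R) (n : nat) : R :=
  \sum_(1 <= k < n.+1) lambda k.

Definition ergodic_mean {R : realType} {H : hilbertType R}
    (lambda : nat -> R) (x : nat -> H) (n : nat) : H :=
  (weight lambda n)^-1 *: \sum_(1 <= k < n.+1) lambda k *: x k.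

(* Main.v *)
Require Import Defs.
From HB Require Import structures.
From mathcomp Require Import all_boot all_order all_algebra.
From mathcomp Require Import all_classical all_reals all_analysis.
From mathcomp Require Import ring lra.

Set Implicit Arguments.
Unset Strict Implicit.
Unset Printing Implicit Defensive.

Import Order.TTheory GRing.Theory Num.Theory.
Import numFieldNormedType.Exports.

Local Open Scope classical_set_scope.
Local Open Scope ring_scope.

(* For a zero u of A + D + N_M, monotonicity of A and D together with the
   Fitzpatrick bound on the penalty term shows that phi_n = |x_n - u|^2
   satisfies an inertial quasi-Fejer inequality whose error terms are summable
   by hypothesis (2). The energy phi_n - alpha_n phi_(n-1)
   + 2 alpha_n |x_n - x_(n-1)|^2 is then decreasing up to a summable error,
   which gives (i) and the convergence of phi_n. For (u, w) in the graph of
   A + D + N_M, summing the same inequality shows that every weak cluster point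
   z of the ergodic means satisfies <w, u - z> >= 0; by maximality of A + N_M
   and a resolvent argument z is a zero, and Opial's lemma in Passty's ergodic
   form gives (ii). Strong monotonicity makes sum_n lambda_n |p_n - u|^2 finite
   while sum_n lambda_n diverges, whence (iii).

   Minty's theorem and weak compactness of bounded sequences both follow from
   the minimisation principle quadratic_minimax. *)

(** * Inner product calculus *)

Section InnerProduct.
Context {R : realType} {H : hilbertType R}.
Implicit Types (u v w : H) (c : R).

Lemma innerC u v : '[u, v] = '[v, u].
Proof. by rewrite hermC /= expr0 mul1r. Qed.

Lemma innerDl u v w : '[u + v, w] = '[u, w] + '[v, w].
Proof. exact: linearDl. Qed.

Lemma innerDr u v w : '[w, u + v] = '[w, u] + '[w, v].
Proof. exact: linearDr. Qed.

Lemma innerNl u w : '[- u, w] = - '[u, w].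
Proof. exact: linearNl. Qed.

Lemma innerNr u w : '[w, - u] = - '[w, u].
Proof. exact: linearNr. Qed.

Lemma innerZl c u w : '[c *: u, w] = c * '[u, w].
Proof. exact: linearZl_LR. Qed.

Lemma innerZr c u w : '[w, c *: u] = c * '[w, u].
Proof. by rewrite innerC innerZl innerC. Qed.

Lemma inner0l w : '[0, w] = 0.
Proof. by rewrite -(scale0r 0) innerZl mul0r. Qed.

Lemma inner0r w : '[w, 0] = 0.
Proof. by rewrite innerC inner0l. Qed.

Definition innerE :=
  (innerDl, innerDr, innerNl, innerNr, innerZl, innerZr, inner0l, inner0r).

Lemma inner_ge0 u : 0 <= '[u, u].
Proof. by rewrite inner_norm sqr_ge0. Qed.

Lemma inner_ext u v : (forall w, '[u, w] = '[v, w]) -> u = v.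
Proof.
move=> uv; apply/eqP; rewrite -subr_eq0 -normr_eq0 -sqrf_eq0 -inner_norm.
by rewrite innerDl innerNl uv subrr.
Qed.

(** Cauchy-Schwarz: for nonzero vectors, expand the square of [|v| u - |u| v] and cancel
    [|u| |v|]. *)
Lemma inner_le u v : '[u, v] <= `|u| * `|v|.
Proof.
have [->|u0] := eqVneq u 0; first by rewrite inner0l normr0 mul0r.
have [->|v0] := eqVneq v 0; first by rewrite inner0r normr0 mulr0.
have u_gt0 : 0 < `|u| by rewrite normr_gt0.
have v_gt0 : 0 < `|v| by rewrite normr_gt0.
have := inner_ge0 (`|v| *: u - `|u| *: v).
rewrite !innerE !inner_norm (innerC v u) => h.
have uv_gt0 := mulr_gt0 u_gt0 v_gt0; nra.
Qed.

Lemma norm_inner_le u v : `|'[u, v]| <= `|u| * `|v|.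
Proof. by rewrite ler_norml inner_le -(normrN u) lerNl -innerNl inner_le. Qed.

Lemma inner_sum (I : Type) (r : seq I) (F : I -> H) w :
  '[\sum_(i <- r) F i, w] = \sum_(i <- r) '[F i, w].
Proof.
elim: r => [|i r IHr]; first by rewrite !big_nil inner0l.
by rewrite !big_cons innerDl IHr.
Qed.

End InnerProduct.

(* Minimise |b|^2 + r over K: minimising sequences are Cauchy by the
   parallelogram law, and the first-order optimality condition at their limit
   a is the conclusion. *)
Lemma quadratic_minimax (R : realType) (H : hilbertType R) (K : H -> R -> Prop)
    (m : R) :
  (exists b r, K b r) ->
  (forall b r b' r' (t : R), 0 <= t -> t <= 1 -> K b r -> K b' r' ->
    K (b + t *: (b' - b)) (r + t * (r' - r))) ->
  (forall b r, K b r -> m <= `|b| ^+ 2 + r) ->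
  exists a : H, forall b r, K b r -> m <= 2 * '[a, b] - `|a| ^+ 2 + r.
Proof.
move=> [b0 [r0 K0]] Kconvex Kge.
pose V := [set `|br.1| ^+ 2 + br.2 | br in [set br : H * R | K br.1 br.2]].
have Vinf : has_inf V.
  split; first by exists (`|b0| ^+ 2 + r0), (b0, r0).
  by exists m => _ [[b r] /= Kbr <-]; exact: Kge.
pose q := inf V.
have qle b r : K b r -> q <= `|b| ^+ 2 + r.
  by move=> Kbr; apply: ge_inf; [case: Vinf|exists (b, r)].
have mq : m <= q.
  by apply: lb_le_inf; [case: Vinf|move=> _ [[b r] /= Kbr <-]; exact: Kge].
have /boolp.choice[s sP] : forall n, exists br : H * R,
    K br.1 br.2 /\ `|br.1| ^+ 2 + br.2 < q + n.+1%:R^-1.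
  move=> n; have n0 : 0 < n.+1%:R^-1 :> R by rewrite invr_gt0 ltr0n.
  by have [_ [br Kbr <-]] := inf_adherent n0 Vinf; exists br.
(* Used twice: [t = 1/2] is the parallelogram estimate behind [scauchy], and small [t] gives the
   optimality condition at the limit. *)
have qmid b r b' r' (t : R) : 0 <= t -> t <= 1 -> K b r -> K b' r' ->
    q <= (1 - t) * (`|b| ^+ 2 + r) + t * (`|b'| ^+ 2 + r')
         - t * (1 - t) * `|b - b'| ^+ 2.
  move=> t0 t1 Kb Kb'; have := qle _ _ (Kconvex _ _ _ _ _ t0 t1 Kb Kb').
  by rewrite -!inner_norm !innerE (innerC b' b) => h; lra.
have scauchy i j : `|(s i).1 - (s j).1| ^+ 2 <= 2 * (i.+1%:R^-1 + j.+1%:R^-1).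
  have [Ki ui] := sP i; have [Kj uj] := sP j.
  have half0 : 0 <= 2^-1 :> R by lra.
  have half1 : 2^-1 <= 1 :> R by lra.
  have := qmid _ _ _ _ _ half0 half1 Ki Kj; move: ui uj.
  move: (i.+1%:R^-1) (j.+1%:R^-1) => u v ui uj h.
  lra.
have inv0 : (fun n : nat => n.+1%:R^-1 : R) @ \oo --> 0 by exact: cvg_harmonic.
have /cauchy_cvgP /cvg_ex[/= a sa] : cauchy ((fun n => (s n).1) @ \oo).
  apply: cauchy_exP => e e0.
  have e4 : 0 < e ^+ 2 / 4 by rewrite divr_gt0// exprn_gt0.
  have inv_lt : \forall n \near \oo, n.+1%:R^-1 < e ^+ 2 / 4 by exact: cvgr_lt inv0 _ e4.
  have [i ui] := filter_ex inv_lt.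
  exists (s i).1; apply: filterS inv_lt => j uj.
  rewrite -ball_normE /=; have := scauchy i j.
  rewrite -(ltr_pXn2r (n := 2)) ?nnegrE ?(ltW e0)//.
  move: (i.+1%:R^-1) (j.+1%:R^-1) ui uj => u v; lra.
exists a => b r Kbr; apply: (le_trans mq).
(* First [n] tends to infinity at fixed [t], so that the optimality gap divided by [t] vanishes;
   only afterwards does [t] tend to 0. *)
have ineq (t : R) : 0 < t -> t <= 1 -> q <= `|b| ^+ 2 + r - (1 - t) * `|a - b| ^+ 2.
  move=> t0 t1.
  have : (fun n => `|b| ^+ 2 + r - (1 - t) * `|(s n).1 - b| ^+ 2 + n.+1%:R^-1 / t)
     @ \oo --> `|b| ^+ 2 + r - (1 - t) * `|a - b| ^+ 2 + 0 / t.
    apply: cvgD; last by apply: cvgM inv0 _; exact: cvg_cst.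
    apply: cvgB; first exact: cvg_cst.
    apply: cvgM; first exact: cvg_cst.
    by apply: cvgM; apply: cvg_norm; apply: cvgB => //; exact: cvg_cst.
  rewrite mul0r addr0 => lim_q.
  apply: (cvgr_to_ge lim_q); apply: nearW => n.
  have [Kn un] := sP n.
  have /(_ (ltW t0) t1) := qmid _ _ _ _ t _ _ Kn Kbr.
  have : 0 < n.+1%:R^-1 :> R by rewrite invr_gt0.
  move: (`|(s n).1| ^+ 2) (`|(s n).1 - b| ^+ 2) (`|b| ^+ 2) (n.+1%:R^-1) un.
  move=> X Y Z u un u0 h; rewrite -(ler_pM2l t0) mulrDr mulrCA divff ?gt_eqF// mulr1.
  have t1' : 0 <= 1 - t by rewrite subr_ge0.
  have un' : 0 <= q + u - (X + (s n).2) by rewrite subr_ge0 ltW.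
  have := mulr_ge0 t1' un'; have := mulr_gt0 t0 u0; lra.
suff : q <= `|b| ^+ 2 + r - `|a - b| ^+ 2.
  by rewrite -!inner_norm !innerE (innerC b a); lra.
have : (fun n : nat => `|b| ^+ 2 + r - (1 - n.+1%:R^-1) * `|a - b| ^+ 2) @ \oo
    --> `|b| ^+ 2 + r - (1 - 0) * `|a - b| ^+ 2.
  apply: cvgB; first exact: cvg_cst.
  by apply: cvgM; [apply: cvgB => //|]; exact: cvg_cst.
rewrite subr0 mul1r => /cvgr_to_ge; apply; apply: nearW => n.
by apply: ineq; rewrite ?invr_gt0// invf_le1// ler1n.
Qed.

(** * Weak cluster points and weak convergence of bounded sequences *)

Section WeakLimits.
Context {R : realType} {H : hilbertType R}.
Implicit Types (z : nat -> H) (a b w : H) (r C : R).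

(* For G = \oo, these are the points of the intersection of the closed convex
   hulls of the tails of z. *)
Definition weak_cluster (G : set_system nat) z a :=
  forall b r, (\forall n \near G, '[z n, b] <= r) -> '[a, b] <= r.

(** Since [|b|^2 - 2 <z n, b> >= - |z n|^2 >= - C^2], the minimisation principle applies to eventual
    upper bounds of [- 2 <z n, b>]. The resulting inequality at large multiples of [- b] leaves only
    its linear part, which is the cluster property. An arbitrary proper filter is allowed so that it
    can be restricted to a set of indices. *)
Lemma bounded_weak_cluster (G : set_system nat) z C : ProperFilter G ->
  (forall n, `|z n| <= C) -> exists a, weak_cluster G z a.
Proof.
move=> PG zC.
pose K b r := \forall n \near G, - (2 * '[z n, b]) <= r.
have C0 : 0 <= C by exact: le_trans (zC 0%N).
have K0 : K 0 0 by apply: nearW => n; rewrite inner0r mulr0 oppr0.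
have Kconvex b r b' r' (t : R) : 0 <= t -> t <= 1 -> K b r -> K b' r' ->
    K (b + t *: (b' - b)) (r + t * (r' - r)).
  move=> t0 t1 Kb Kb'; apply: filterS2 Kb Kb' => n h h'.
  have t1' : 0 <= 1 - t by rewrite subr_ge0.
  rewrite !innerE; move: ('[z n, b]) ('[z n, b']) h h' => X X' h h'.
  have := ler_wpM2l t0 h'; have := ler_wpM2l t1' h; lra.
have Kge b r : K b r -> - C ^+ 2 <= `|b| ^+ 2 + r.
  move=> Kbr; have [n h] := filter_ex Kbr.
  have : 0 <= `|b - z n| ^+ 2 by rewrite sqr_ge0.
  have : `|z n| ^+ 2 <= C ^+ 2 by rewrite lerXn2r// nnegrE.
  rewrite -!inner_norm !innerE (innerC b (z n)); lra.
have [a aK] := quadratic_minimax (ex_intro _ 0 (ex_intro _ 0 K0)) Kconvex Kge.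
exists a => b r br; rewrite leNgt; apply/negP => r_lt.
set X := '[a, b] - r; have X0 : 0 < X by rewrite subr_gt0.
(* Chosen so that [2 * t * X = C ^+ 2 + 1], just beyond the lower bound [- C ^+ 2]. *)
pose t := (C ^+ 2 + 1) / (2 * X).
have t0 : 0 <= t by rewrite divr_ge0 ?addr_ge0 ?sqr_ge0// mulr_ge0// ltW.
have /aK : K (- (t *: b)) (2 * (t * r)).
  apply: filterS br => n h; rewrite !innerE mulrN opprK ler_pM2l//.
  by rewrite ler_wpM2l.
rewrite !innerE.
have -> : 2 * - (t * '[a, b]) - `|a| ^+ 2 + 2 * (t * r) = - (t * (2 * X)) - `|a| ^+ 2.
  by rewrite /X; ring.
rewrite /t divfK ?mulf_neq0 ?gt_eqF//.
have := sqr_ge0 `|a|; lra.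
Qed.

(** If [<z n, b>] exceeds [<w, b> + e] infinitely often, the trace of the filter on those indices
    has a cluster point. It is also one of the whole sequence, hence equals [w], yet lies beyond the
    half-space. *)
Lemma bounded_weak_cvg z C : (forall n, `|z n| <= C) ->
  (forall a b, weak_cluster \oo z a -> weak_cluster \oo z b -> a = b) ->
  exists2 w, weak_cluster \oo z w & weak_cvg z w.
Proof.
move=> zC zuniq; have [w wz] := @bounded_weak_cluster \oo z C _ zC.
exists w => // u.
have upper b e : 0 < e -> \forall n \near \oo, '[z n, b] <= '[w, b] + e.
  move=> e0; apply: contrapT => often.
  pose S := [set n | '[w, b] + e < '[z n, b]].
  have PS : ProperFilter (within S \oo).
    apply: Build_ProperFilter_ex => P SP; apply: contrapT => nP.
    apply: often; have : \forall n \near \oo, S n -> P n := SP.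
      apply: filterS => n SPn.
    by rewrite leNgt; apply/negP => Sn; apply: nP; exists n; exact: SPn.
  have [a aS] := bounded_weak_cluster PS zC.
  have aw : a = w.
    by apply: zuniq => // b' r br; apply: aS; apply: filterS br => n + _.
  have : '[a, - b] <= - ('[w, b] + e).
    apply: aS; rewrite near_withinE; apply: nearW => n Sn.
    by rewrite innerNr lerN2 ltW.
  by rewrite aw innerNr; lra.
apply/cvgrPdist_le => e e0.
near=> n; rewrite ler_norml; apply/andP; split.
  have : '[z n, u] <= '[w, u] + e by near: n; exact: upper.
  lra.
have : '[z n, - u] <= '[w, - u] + e by near: n; exact: upper.
by rewrite !innerNr; lra.
Unshelve. all: by end_near. Qed.

End WeakLimits.

(** * Minty's theorem and consequences of maximality *)

Section MaximalMonotonicity.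
Context {R : realType} {H : hilbertType R}.
Implicit Types (T : H -> set H) (x y u v z : H).

(** The convex hull in [H * H * R] of the lifted graph, shifted by [z]. Binary combinations give the
    convexity required for minimisation, and inequalities pass to the hull by induction. *)
Inductive graph_hull T z : H -> H -> R -> Prop :=
| GraphHullBase y v : T y v -> graph_hull T z y (v - z) '[y, v - z]
| GraphHullConv y v s y' v' s' t : 0 <= t -> t <= 1 ->
    graph_hull T z y v s -> graph_hull T z y' v' s' ->
    graph_hull T z (y + t *: (y' - y)) (v + t *: (v' - v)) (s + t * (s' - s)).

(** For two triples, [s + s' - <y, v'> - <y', v>] is affine in each triple separately and
    nonnegative on generators by monotonicity. Inducting on one triple and then on the other makes
    it nonnegative on the hull; the diagonal gives the claim. *)
Lemma graph_hull_inner T z y v s :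
  monotone_op T -> graph_hull T z y v s -> '[y, v] <= s.
Proof.
move=> monT hyvs.
have base y0 v0 y1 v1 s1 : T y0 v0 -> graph_hull T z y1 v1 s1 ->
    0 <= s1 - '[y1, v0 - z] - '[y0, v1] + '[y0, v0 - z].
  move=> Tyv0; elim=> [y2 v2 Tyv2|y2 v2 s2 y3 v3 s3 t t0 t1 _ IH2 _ IH3].
    have := monT _ _ _ _ Tyv2 Tyv0.
    by rewrite !innerE; lra.
  have t1' : 0 <= 1 - t by rewrite subr_ge0.
  have := mulr_ge0 t1' IH2; have := mulr_ge0 t0 IH3.
  by rewrite !innerE; lra.
have both y1 v1 s1 : graph_hull T z y1 v1 s1 ->
    0 <= s + s1 - '[y, v1] - '[y1, v].
  elim=> [y2 v2 Tyv2|y2 v2 s2 y3 v3 s3 t t0 t1 _ IH2 _ IH3].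
    have := base _ _ _ _ _ Tyv2 hyvs.
    by rewrite !innerE; lra.
  have t1' : 0 <= 1 - t by rewrite subr_ge0.
  have := mulr_ge0 t1' IH2; have := mulr_ge0 t0 IH3.
  by rewrite !innerE; lra.
have := both _ _ _ hyvs; lra.
Qed.

(** The core of Minty's theorem. With [b = (y - v) / 2] on the hull,
    [|b|^2 + s >= |y + v|^2 / 4 >= 0]; the minimisation principle with [m = 0] then returns [a] with
    [0 <= <y - a, v - z + a>] on the graph. *)
Lemma monotone_resolvent_related T z : monotone_op T ->
  exists x, forall y v, T y v -> 0 <= '[y - x, v - (z - x)].
Proof.
move=> monT.
have [[y0 [v0 T0]]|noT] := pselect (exists y v, T y v); last first.
  by exists 0 => y v Tyv; case: noT; exists y, v.
pose K b s := exists y v, graph_hull T z y v s /\ b = 2^-1 *: (y - v).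
have Kne : exists b s, K b s.
  exists (2^-1 *: (y0 - (v0 - z))), '[y0, v0 - z].
  by exists y0, (v0 - z); split=> //; exact: GraphHullBase.
have Kconvex b r b' r' (t : R) : 0 <= t -> t <= 1 -> K b r -> K b' r' ->
    K (b + t *: (b' - b)) (r + t * (r' - r)).
  move=> t0 t1 [y [v [h ->]]] [y' [v' [h' ->]]].
  exists (y + t *: (y' - y)), (v + t *: (v' - v)); split.
    exact: GraphHullConv.
  rewrite -scalerBr scalerA mulrC -scalerA -scalerDr (opprD v) addrACA -scalerBr.
  by congr (_ *: (_ + _ *: _)); rewrite !opprD !opprK addrACA.
have Kge b s : K b s -> 0 <= `|b| ^+ 2 + s.
  move=> [y [v [h ->]]]; have := graph_hull_inner monT h.
  have := inner_ge0 (y + v).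
  by rewrite -inner_norm !innerE (innerC v y); lra.
have [a aK] := quadratic_minimax Kne Kconvex Kge.
exists a => y v Tyv.
have /aK : K (2^-1 *: (y - (v - z))) '[y, v - z].
  by exists y, (v - z); split=> //; exact: GraphHullBase.
rewrite -inner_norm !innerE.
rewrite (innerC a y) (innerC a v) (innerC a z); lra.
Qed.

(** Adjoining [(x, u)] keeps the graph monotone, so maximality puts it there already. *)
Lemma maximally_monotone_mem T x u : maximally_monotone T ->
  (forall y v, T y v -> 0 <= '[y - x, v - u]) -> T x u.
Proof.
move=> [monT maxT] related.
pose S y := T y `|` [set v | y = x /\ v = u].
suff ST : gr S = gr T.
  suff : gr S (x, u) by rewrite ST.
  by right.
apply: maxT => [y v y' v'|[y v] Tyv]; last by left.
case=> [Tyv|/= [-> ->]] [Tyv'|/= [-> ->]].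
- exact: monT.
- exact: related.
- by have := related _ _ Tyv'; rewrite !innerE; lra.
- by rewrite !subrr inner0l.
Qed.

(** Minty's theorem for [c T]: a point monotonically related to the graph of [c T] becomes, after
    division by [c], related to that of [T]. *)
Lemma maximally_monotone_resolvent T (c : R) z : maximally_monotone T -> 0 < c ->
  exists x, T x (c^-1 *: (z - x)).
Proof.
move=> maxT c0; have [monT _] := maxT.
have moncT : monotone_op (op_scale c T).
  move=> y u y' u' [v Tyv /= <-] [v' Tyv' /= <-].
  by rewrite -scalerBr innerZr mulr_ge0 ?(ltW c0)//; exact: monT.
have [x xP] := monotone_resolvent_related z moncT.
exists x; apply: maximally_monotone_mem => // y v Tyv.
rewrite -(pmulr_rge0 _ c0) -innerZr scalerBr scalerA divff ?gt_eqF// scale1r.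
by apply: xP; exists v.
Qed.

(* Passing through a resolvent of T replaces the maximality of T + D. *)
Lemma lipschitz_perturbation_zero T (D : H -> H) (k : R) z :
  maximally_monotone T -> 0 < k -> k.-lipschitz D ->
  (forall y v, T y v -> 0 <= '[y - z, v + D y]) -> T z (- D z).
Proof.
move=> maxT k0 lipD related.
(* With [x] the resolvent of the forward step at [z], the hypothesis reads
   [<x - z, Dx - Dz> >= 2 k |x - z|^2]. The Lipschitz bound allows only [k |x - z|^2], so
   [x = z]. *)
have c0 : 0 < (2 * k)^-1 by rewrite invr_gt0 mulr_gt0.
have [x Tx] := maximally_monotone_resolvent (z - (2 * k)^-1 *: D z) maxT c0.
suff xz : x = z.
  move: Tx; rewrite xz addrAC subrr add0r scalerN scalerA mulVf ?scale1r//.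
  by rewrite gt_eqF.
apply/eqP; rewrite -subr_eq0 -normr_eq0 -sqrf_eq0 eq_le sqr_ge0 andbT.
have := related _ _ Tx; rewrite invrK.
have -> : (2 * k) *: (z - (2 * k)^-1 *: D z - x) + D x =
    - ((2 * k) *: (x - z)) + (D x - D z).
  rewrite addrAC scalerBr scalerA mulfV ?gt_eqF ?mulr_gt0// scale1r.
  by rewrite -scalerN opprB -addrA (addrC (- _)).
have lipDxz : `|D x - D z| <= k * `|x - z| by exact: (lipD (x, z)).
have := inner_le (x - z) (D x - D z).
rewrite !(innerDr (- _)) innerNr innerZr inner_norm.
have := ler_wpM2l (normr_ge0 (x - z)) lipDxz.
nra.
Qed.

End MaximalMonotonicity.

(** * Partial sums bounded above, and weighted means *)

Section RealSeries.
Context {R : realType}.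
Implicit Types (f g lam u : nat -> R) (l C : R).

(** One-sided, because some error terms have no sign; for nonnegative [f] it is summability. *)
Definition bounded_sums (m : nat) f :=
  exists C, forall N, \sum_(m <= k < N) f k <= C.

Lemma bounded_sums_from (m n0 : nat) f C :
  (forall N, (n0 <= N)%N -> \sum_(m <= k < N) f k <= C) -> bounded_sums m f.
Proof.
move=> fC; exists (`|C| + \sum_(m <= k < n0) `|f k|) => N.
have [n0N|Nn0] := leqP n0 N.
  apply: (le_trans (fC _ n0N)); apply: (le_trans (ler_norm C)).
  by rewrite lerDl sumr_ge0.
have [mN|Nm] := leqP m N; last first.
  by rewrite big_geq ?(ltnW Nm)// addr_ge0// sumr_ge0.
rewrite (@big_cat_nat _ _ _ N m n0) ?(ltnW Nn0)//= addrA.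
rewrite -[leLHS]addr0 lerD ?sumr_ge0//.
rewrite -[leLHS]add0r lerD//; apply: ler_sum => k _; exact: ler_norm.
Qed.

Lemma bounded_sums_le (m m' n0 : nat) f g :
  (forall k, (n0 <= k)%N -> g k <= f k) -> bounded_sums m f -> bounded_sums m' g.
Proof.
move=> gf [C fC].
pose n1 := maxn n0 (maxn m m').
have [n01 m1 m'1] : [/\ (n0 <= n1)%N, (m <= n1)%N & (m' <= n1)%N].
  by rewrite !leq_max !leqnn !orbT.
apply: (@bounded_sums_from _ n1 _
  (\sum_(m' <= k < n1) g k + (C - \sum_(m <= k < n1) f k))) => N n1N.
rewrite (@big_cat_nat _ _ _ n1)//= lerD2l lerBrDl.
apply: le_trans (fC N); rewrite [leRHS](@big_cat_nat _ _ _ n1)//= lerD2l.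
by apply: ler_sum_nat => k /andP[n1k _]; apply: gf; exact: leq_trans n1k.
Qed.

Lemma bounded_sumsD (m : nat) f g :
  bounded_sums m f -> bounded_sums m g -> bounded_sums m (fun k => f k + g k).
Proof.
by move=> [C fC] [C' gC']; exists (C + C') => N; rewrite big_split lerD.
Qed.

Lemma bounded_sumsZ (m : nat) (c : R) f : 0 <= c ->
  bounded_sums m f -> bounded_sums m (fun k => c * f k).
Proof.
by move=> c0 [C fC]; exists (c * C) => N; rewrite -big_distrr ler_wpM2l.
Qed.

Lemma bounded_sums_pred (m : nat) f :
  bounded_sums m (fun k => f k.+1) -> bounded_sums m.+1 f.
Proof.
by move=> [C fC]; apply: (@bounded_sums_from _ 1%N _ C) => -[//|N] _; rewrite big_add1.
Qed.

Lemma bounded_sums_cvg (m : nat) f :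
  (forall k, 0 <= f k) -> bounded_sums m f -> cvgn (series f).
Proof.
move=> f0 fb; have [C fC] : bounded_sums 0 f.
  exact: (@bounded_sums_le m 0 0 f).
apply: nondecreasing_is_cvgn.
  by apply/nondecreasing_seqP => n; rewrite /series /= big_nat_recr//= lerDl.
by exists C => _ [n _ <-]; exact: fC.
Qed.

Lemma bounded_sums_cvg0 (m : nat) f :
  (forall k, 0 <= f k) -> bounded_sums m f -> f @ \oo --> 0.
Proof. by move=> f0 /(bounded_sums_cvg f0) /cvg_series_cvg_0. Qed.

Lemma bounded_sums_nneseries (m : nat) f : (forall k, 0 <= f k) ->
  bounded_sums m f -> (\sum_(m <= n <oo) (f n)%:E < +oo)%E.
Proof.
move=> f0 [C fC]; apply: (@le_lt_trans _ _ C%:E); last exact: ltry.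
apply: lime_le; first by apply: is_cvg_nneseries => n _ _; rewrite lee_fin.
by apply: nearW => N; rewrite sumEFin lee_fin.
Qed.

Lemma nneseries_bounded_sums (m : nat) (v : nat -> \bar R) :
  (forall n, (m <= n)%N -> (0 <= v n)%E) ->
  (\sum_(m <= n <oo) v n < +oo)%E ->
  (forall n, (m <= n)%N -> v n \is a fin_num) /\
  bounded_sums m (fun n => fine (v n)).
Proof.
move=> v0 vlty.
have sum_le N : (\sum_(m <= k < N) v k <= \sum_(m <= n <oo) v n)%E.
  by apply: nneseries_lim_ge => n mn _; exact: v0.
have vfin n : (m <= n)%N -> v n \is a fin_num.
  move=> mn; rewrite ge0_fin_numE ?v0//; apply: le_lt_trans vlty.
  apply: le_trans (sum_le n.+1); rewrite big_nat_recr//= leeDr//.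
  by rewrite big_nat_cond sume_ge0// => k /andP[/andP[mk _] _]; exact: v0.
split=> //; exists (fine (\sum_(m <= n <oo) v n)%E) => N.
have -> : \sum_(m <= k < N) fine (v k) = fine (\sum_(m <= k < N) v k)%E.
  rewrite big_nat_cond [in RHS]big_nat_cond sum_fine// => k /andP[/andP[mk _] _].
  exact: vfin.
rewrite fine_le//.
- rewrite big_nat_cond sum_fin_num; apply/allP => y /mapP[k].
  by rewrite mem_filter => /andP[/andP[/andP[mk _] _] _] ->; exact: vfin.
- by rewrite ge0_fin_numE// (le_trans _ (sum_le m))// big_geq.
Qed.

Definition weighted_mean lam u n :=
  (weight lam n)^-1 * \sum_(1 <= k < n.+1) lam k * u k.

Section WeightedMean.
Variable lam : nat -> R.
Hypotheses (lam0 : forall k, (1 <= k)%N -> 0 <= lam k).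
Hypothesis (lam_unb : ~ bounded_sums 1 lam).

Lemma weight_large C : \forall n \near \oo, C < weight lam n.
Proof.
have [n Cn] : exists n, C < weight lam n.
  apply: contrapT => noN; apply: lam_unb.
  apply: (@bounded_sums_from _ 1%N _ C) => -[//|N] _.
  by rewrite leNgt; apply/negP => ?; apply: noN; exists N.
exists n => // j /= nj; apply: (lt_le_trans Cn).
rewrite /weight [leRHS](@big_cat_nat _ _ _ n.+1)//= lerDl.
rewrite big_nat_cond sumr_ge0// => k /andP[/andP[nk _] _].
by apply: lam0; exact: leq_trans nk.
Qed.

(** The accumulated excess over [c] is at most [C], hence below [e] times the weight once the weight
    passes [C / e]. *)
Lemma weighted_mean_le u (c e : R) :
  bounded_sums 1 (fun k => lam k * (u k - c)) -> 0 < e ->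
  \forall n \near \oo, weighted_mean lam u n <= c + e.
Proof.
move=> [C uC] e0; near=> n.
have W0 : 0 < weight lam n by near: n; exact: weight_large.
have WC : C / e < weight lam n by near: n; exact: weight_large.
rewrite /weighted_mean mulrC ler_pdivrMr//.
have := uC n.+1; under eq_bigr do rewrite mulrBr.
rewrite sumrB -big_distrl -/(weight lam n) /=.
by move: WC; rewrite ltr_pdivrMr//; lra.
Unshelve. all: by end_near. Qed.

Lemma weighted_meanN u n :
  weighted_mean lam (fun k => - u k) n = - weighted_mean lam u n.
Proof. by rewrite /weighted_mean -mulrN -sumrN; under eq_bigr do rewrite mulrN. Qed.

(** Cesaro-Toeplitz: the upper estimate is applied to [u] and to [- u]. *)
Lemma weighted_mean_cvg u l : u @ \oo --> l -> weighted_mean lam u @ \oo --> l.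
Proof.
have upper v c e : v @ \oo --> c -> 0 < e ->
    \forall n \near \oo, weighted_mean lam v n <= c + e.
  move=> vc e0; have e2 : 0 < e / 2 by rewrite divr_gt0.
  have -> : c + e = c + e / 2 + e / 2 by lra.
  apply: weighted_mean_le => //.
  have /cvgrPdist_le /(_ _ e2) [n0 _ vn0] := vc.
  (* Beyond [n0] the terms [lam k * (v k - (c + e / 2))] are nonpositive, so the zero sequence
     dominates them. *)
  apply: (@bounded_sums_le 0 1 n0.+1 (fun=> 0)); last first.
    by exists 0 => N; rewrite sumr_const_nat mul0rn.
  move=> k n0k; rewrite mulr_ge0_le0 ?lam0//; first exact: leq_trans n0k.
  have := vn0 k (ltnW n0k); rewrite /= distrC => /(le_trans (ler_norm _)); lra.
move=> ul; apply/cvgrPdist_le => e e0; near=> n.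
have : weighted_mean lam (fun k => - u k) n <= - l + e.
  by near: n; apply: upper => //; exact: cvgN.
have : weighted_mean lam u n <= l + e by near: n; exact: upper.
by rewrite weighted_meanN ler_norml => ? ?; apply/andP; split; lra.
Unshelve. all: by end_near. Qed.

End WeightedMean.

Lemma descent_sums (n0 : nat) (mu c b : nat -> R) :
  (forall k, (n0 <= k)%N -> mu k.+1 + c k <= mu k + b k) ->
  forall N, (n0 <= N)%N ->
    mu N + \sum_(n0 <= k < N) c k <= mu n0 + \sum_(n0 <= k < N) b k.
Proof.
move=> step; elim=> [|N IHN].
  by rewrite leqn0 => /eqP ->; rewrite !big_geq.
rewrite leq_eqVlt => /predU1P[<-|]; first by rewrite !big_geq.
rewrite ltnS => n0N; rewrite !big_nat_recr//=.
have := IHN n0N; have := step _ n0N; lra.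
Qed.

Lemma eventually_nonincreasing_cvg (n0 : nat) u C :
  (forall n, (n0 <= n)%N -> u n.+1 <= u n) ->
  (forall n, (n0 <= n)%N -> C <= u n) -> cvgn u.
Proof.
move=> udec uC.
have : cvgn (fun n => u (n + n0)%N).
  apply: nonincreasing_is_cvgn.
    by apply/nonincreasing_seqP => n; apply: udec; rewrite leq_addl.
  by exists C => _ [n _ <-]; apply: uC; rewrite leq_addl.
by move=> /cvg_ex[l]; rewrite (cvg_shiftn n0) => ul; apply/cvg_ex; exists l.
Qed.

End RealSeries.

(** * Inertial quasi-Fejer recursions for real sequences *)

Section InertialSequences.
Context {R : realType}.
Variables (n0 : nat) (al phi d e b : nat -> R) (a s : R).
Hypotheses (al_bound : forall n, (n0 <= n)%N -> 0 <= al n <= a).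
Hypothesis (al_incr : forall n, (n0 <= n)%N -> al n <= al n.+1).
Hypotheses (a1 : a < 1) (s0 : 0 < s).
Hypotheses (phi0 : forall n, 0 <= phi n).
Hypotheses (d0 : forall n, 0 <= d n) (e0 : forall n, 0 <= e n).
Hypothesis phi_step : forall n, (n0 <= n)%N ->
  phi n.+1 - phi n <= al n * (phi n - phi n.-1) + 2 * al n * d n
    - (2 * a + s / 2) * d n.+1 - s * e n + b n.

Definition inertial_energy n := phi n - al n * phi n.-1 + 2 * al n * d n.

(** Monotonicity of [al] gives [(al n - al n.+1) * phi n <= 0], and [al n.+1 <= a] lets the [2 * a]
    of [phi_step] absorb the new [2 * al n.+1 * d n.+1], leaving the margin [s / 2]. *)
Lemma inertial_energy_step n : (n0 <= n)%N ->
  inertial_energy n.+1 + (s / 2 * d n.+1 + s * e n) <= inertial_energy n + b n.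
Proof.
move=> n0n; rewrite /inertial_energy /=.
have /andP[_ al1] := al_bound (leqW n0n).
have /andP[al0 _] := al_bound n0n.
have := phi_step n0n.
have := ler_wpM2r (phi0 n) (al_incr n0n).
have := ler_wpM2r (d0 n.+1) al1.
lra.
Qed.

Lemma inertial_energy_ge n : (n0 <= n)%N -> phi n - a * phi n.-1 <= inertial_energy n.
Proof.
move=> n0n; have /andP[al0 al1] := al_bound n0n.
have := ler_wpM2r (phi0 n.-1) al1; have := mulr_ge0 al0 (d0 n).
rewrite /inertial_energy; lra.
Qed.

Lemma inertial_energy_sums N : (n0 <= N)%N ->
  inertial_energy N + \sum_(n0 <= k < N) (s / 2 * d k.+1 + s * e k)
    <= inertial_energy n0 + \sum_(n0 <= k < N) b k.
Proof. by apply: descent_sums => n; exact: inertial_energy_step. Qed.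

Lemma inertial_sum_ge0 N : 0 <= \sum_(n0 <= k < N) (s / 2 * d k.+1 + s * e k).
Proof.
by apply: sumr_ge0 => k _; rewrite addr_ge0// mulr_ge0// ltW// divr_gt0.
Qed.

Lemma inertial_le (N : nat) : (n0 <= N)%N ->
  phi N - a * phi N.-1 <= inertial_energy n0 + \sum_(n0 <= k < N) b k.
Proof.
move=> n0N; have := inertial_energy_ge n0N; have := inertial_energy_sums n0N.
have := inertial_sum_ge0 N; lra.
Qed.

Lemma inertial_bounded : bounded_sums n0 b -> exists M, forall n, phi n <= M.
Proof.
move=> [C bC].
pose C' := inertial_energy n0 + C.
(* A level preserved by [phi N <= a * phi N.-1 + C'], since [C' + a * M <= M]; the added sum covers
   the indices up to [n0]. *)
pose M := `|C'| / (1 - a) + \sum_(0 <= k < n0.+1) phi k.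
have a1' : 0 < 1 - a by rewrite subr_gt0.
have sum_ge0 : 0 <= \sum_(0 <= k < n0.+1) phi k by exact: sumr_ge0.
have a0 : 0 <= a by have /andP[/le_trans] := al_bound (leqnn n0); exact.
have C'M : C' <= (1 - a) * M.
  rewrite mulrDr mulrCA divff ?gt_eqF// mulr1 (le_trans (ler_norm _))// lerDl.
  by rewrite mulr_ge0// ltW.
exists M; elim=> [|n IHn].
  rewrite /M big_nat_recl//= addrCA lerDl addr_ge0//; last exact: sumr_ge0.
  by rewrite divr_ge0// ltW.
have [n0n|nn0] := ltnP n0 n.+1; last first.
  have q0 : 0 <= `|C'| / (1 - a) by rewrite divr_ge0// ltW.
  have S1 : 0 <= \sum_(0 <= k < n.+1) phi k by exact: sumr_ge0.
  have S2 : 0 <= \sum_(n.+2 <= k < n0.+1) phi k by exact: sumr_ge0.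
  rewrite /M (@big_cat_nat _ _ _ n.+1)//=; last exact: leqW.
  by rewrite (@big_ltn _ _ _ n.+1)//=; lra.
have := inertial_le (ltnW n0n); rewrite /= => h.
have := bC n.+1; have := ler_wpM2l a0 IHn; rewrite /C' in C'M; lra.
Qed.

Lemma inertial_energy_lb M : (forall n, phi n <= M) ->
  forall n, (n0 <= n)%N -> - (a * M) <= inertial_energy n.
Proof.
move=> phiM n n0n; apply: le_trans (inertial_energy_ge n0n).
have a0 : 0 <= a by have /andP[/le_trans] := al_bound (leqnn n0); exact.
have := ler_wpM2l a0 (phiM n.-1); have := phi0 n; lra.
Qed.

(** The energy inequality read backwards: for bounded [phi] the energy is bounded below, so the sums
    of [b] cannot tend to minus infinity. Here [b] may have any sign. *)
Lemma inertial_drift M : (forall n, phi n <= M) ->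
  bounded_sums n0 (fun k => - b k).
Proof.
move=> phiM.
apply: (@bounded_sums_from _ _ n0 _ (inertial_energy n0 + a * M)) => N n0N.
have := inertial_energy_lb phiM n0N; have := inertial_energy_sums n0N.
have := inertial_sum_ge0 N; rewrite sumrN; lra.
Qed.

Lemma inertial_summable (m : nat) : bounded_sums n0 b ->
  bounded_sums m d /\ bounded_sums m e.
Proof.
move=> bb; have [M phiM] := inertial_bounded bb; have [C bC] := bb.
have cb : bounded_sums n0 (fun k => s / 2 * d k.+1 + s * e k).
  apply: (@bounded_sums_from _ _ n0 _ (inertial_energy n0 + C + a * M)) => N n0N.
  have := inertial_energy_lb phiM n0N; have := inertial_energy_sums n0N.
  have := bC N; lra.
have s2 : 0 <= 2 / s by rewrite divr_ge0 ?(ltW s0).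
have s1 : 0 <= s^-1 by rewrite invr_ge0 ltW.
split.
  have /bounded_sums_pred : bounded_sums n0 (fun k => d k.+1).
    apply: (@bounded_sums_le _ n0 n0 0 _ _ _ (bounded_sumsZ s2 cb)) => k _.
    rewrite (_ : 2 / s * _ = d k.+1 + 2 * e k); last by field; rewrite gt_eqF.
    by rewrite lerDl mulr_ge0.
  exact: (@bounded_sums_le _ n0.+1 m 0).
apply: (@bounded_sums_le _ n0 m 0 _ _ _ (bounded_sumsZ s1 cb)) => k _.
rewrite (_ : s^-1 * _ = 2^-1 * d k.+1 + e k); last by field; rewrite gt_eqF.
by rewrite lerDr mulr_ge0.
Qed.

(** The energy minus the partial sums of [b] is eventually nonincreasing and bounded below, so the
    energy converges. Up to vanishing terms it equals [(1 - al n) * phi n], and the limit of [al] is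
    below 1. *)
Lemma inertial_cvg : (forall n, 0 <= b n) -> bounded_sums n0 b ->
  (fun n => phi n - phi n.-1) @ \oo --> 0 -> cvgn phi.
Proof.
move=> b0 bb dphi; have [M phiM] := inertial_bounded bb.
have [db _] := inertial_summable 0 bb.
have dcvg := bounded_sums_cvg0 d0 db.
have /cvg_ex[/= B bB] := bounded_sums_cvg b0 bb.
have /cvg_ex[/= al' alcvg] : cvgn al.
  rewrite -is_cvgNE; apply: (@eventually_nonincreasing_cvg _ n0 _ (- a)) => n n0n /=.
    by rewrite lerN2 al_incr.
  by rewrite lerN2; have /andP[] := al_bound n0n.
have al'1 : al' < 1.
  apply: le_lt_trans a1; apply: (cvgr_to_le alcvg).
  by exists n0 => // n; move=> /al_bound /andP[].
have /cvg_ex[/= L enL] : cvgn (fun n => inertial_energy n - series b n).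
  apply: (@eventually_nonincreasing_cvg _ n0 _ (- (a * M) - B)) => n n0n /=.
    rewrite /series /= big_nat_recr//=.
    have := inertial_energy_step n0n.
    have := mulr_ge0 (ltW s0) (d0 n.+1); have := mulr_ge0 (ltW s0) (e0 n); lra.
  rewrite lerB ?inertial_energy_lb//.
  apply: (cvgr_to_ge bB); exists n => // j /= nj.
  rewrite /series /= [leRHS](@big_cat_nat _ _ _ n)//= lerDl.
  exact: sumr_ge0.
have encvg : inertial_energy @ \oo --> L + B.
  have -> : inertial_energy = fun n => inertial_energy n - series b n + series b n.
    by apply/funext => n; rewrite subrK.
  exact: cvgD.
apply/cvg_ex; exists ((L + B - al' * 0 - 2 * al' * 0) / (1 - al')).
have : (fun n => (inertial_energy n - al n * (phi n - phi n.-1)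
      - 2 * al n * d n) / (1 - al n)) @ \oo -->
    (L + B - al' * 0 - 2 * al' * 0) / (1 - al').
  apply: cvgM; last first.
    apply: cvgV; first by rewrite subr_eq0 gt_eqF.
    by apply: cvgB => //; exact: cvg_cst.
  apply: cvgB; first by apply: cvgB => //; exact: cvgM.
  by apply: cvgM => //; apply: cvgM => //; exact: cvg_cst.
apply: cvg_trans; apply: near_eq_cvg; exists n0 => // n n0n /=.
have /andP[_ al_a] := al_bound n0n.
have al1 : 1 - al n != 0 by rewrite subr_eq0 gt_eqF// (le_lt_trans al_a).
by apply: (mulIf al1); rewrite divfK// /inertial_energy; ring.
Qed.

End InertialSequences.

(** * Ergodic means and the inequality for one iteration *)

Section PenalizedTseng.
Context {R : realType} {H : hilbertType R}.

Lemma cvg0_sqr_norm (V : normedModType R) (f : nat -> V) :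
  (fun n => `|f n| ^+ 2) @ \oo --> 0 -> f @ \oo --> 0.
Proof.
move=> /cvgrPdist_lt f2; apply/cvgrPdist_lt => e e0.
have /f2 : 0 < e ^+ 2 by rewrite exprn_gt0.
apply: filterS => n; rewrite !sub0r !normrN ger0_norm ?sqr_ge0//.
by rewrite ltr_pXn2r// nnegrE// ltW.
Qed.

(** The half-space test is applied to [b] and to [- b]. *)
Lemma weak_cluster_cvg (z : nat -> H) (c b : H) (l : R) :
  weak_cluster \oo z c -> '[z n, b] @[n --> \oo] --> l -> '[c, b] = l.
Proof.
have upper b' l' : weak_cluster \oo z c -> '[z n, b'] @[n --> \oo] --> l' ->
    '[c, b'] <= l'.
  move=> zc zl; apply/ler_addgt0Pr => e e0; apply: zc.
  by apply: cvgr_le zl _ _; rewrite ltrDl.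
move=> zc zl; apply: le_anti; rewrite upper//= -lerN2 -innerNr upper//.
by rewrite (_ : (fun n => _) = fun n => - '[z n, b]);
  [exact: cvgN|apply/funext => n; rewrite innerNr].
Qed.

Lemma inner_ergodic_mean (lam : nat -> R) (x : nat -> H) (b : H) n :
  '[ergodic_mean lam x n, b] = weighted_mean lam (fun k => '[x k, b]) n.
Proof.
rewrite innerZl inner_sum; congr (_ * _).
by apply: eq_bigr => k _; rewrite innerZl.
Qed.

Lemma norm_ergodic_mean_le (lam : nat -> R) (x : nat -> H) (C : R) :
  (forall k, (1 <= k)%N -> 0 <= lam k) -> (forall k, `|x k| <= C) ->
  forall n, `|ergodic_mean lam x n| <= C.
Proof.
move=> lam0 xC n.
have W0 : 0 <= weight lam n.
  by rewrite /weight big_nat_cond sumr_ge0// => k /andP[/andP[k1 _] _]; exact: lam0.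
rewrite normrZ normfV ger0_norm//.
(* At zero weight, as for [n = 0], the mean is 0 by the convention [0^-1 = 0]. *)
have [->|Wn0] := eqVneq (weight lam n) 0.
  by rewrite invr0 mul0r (le_trans _ (xC 0%N)).
rewrite mulrC ler_pdivrMr ?lt0r ?Wn0// mulr_sumr.
apply: (le_trans (ler_norm_sum _ _ _)); apply: ler_sum_nat => k /andP[k1 _].
by rewrite normrZ ger0_norm ?lam0// mulrC ler_wpM2r// lam0.
Qed.

(* With e = p_n - u, f = x_n - p_n, g = x_(n+1) - p_n, h = x_n - x_(n-1),
   the vector f - g + al h - lam Dp - (lam beta) Bp is lam times the element
   of A p_n provided by the resolvent. *)
Lemma tseng_inequality (e f g h Dp Du Bp v q : H) (al lam beta L gamma : R) :
  0 < lam -> 0 < beta -> 0 <= al ->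
  lam * (gamma * `|e| ^+ 2) <=
    '[e, f - g + al *: h - lam *: Dp - (lam * beta) *: Bp - lam *: v] ->
  0 <= '[e, Dp - Du] -> `|g| ^+ 2 <= L ^+ 2 * `|f| ^+ 2 ->
  `|e + g| ^+ 2 - `|e + f| ^+ 2 <=
    al * (`|e + f| ^+ 2 - `|e + f - h| ^+ 2) + 2 * al * `|h| ^+ 2
    - (1 - al - L ^+ 2) * `|f| ^+ 2
    + (2 * (lam * beta * ('[e, beta^-1 *: q] - '[e, Bp]))
       - 2 * (lam * '[v + Du + q, e]) - 2 * (lam * (gamma * `|e| ^+ 2))).
Proof.
move=> lam0 beta0 al0 resA monD gf.
have := mulr_ge0 (ltW lam0) monD.
(* Absorbs the cross term [2 al <f, h>], at the price of the [al] subtracted from the coefficient of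
   [|f|^2]. *)
have := mulr_ge0 al0 (inner_ge0 (h + f)).
have -> : lam * beta * ('[e, beta^-1 *: q] - '[e, Bp]) =
    lam * '[e, q] - lam * beta * '[e, Bp].
  by rewrite innerZr; field; rewrite gt_eqF.
move: resA gf; rewrite -!inner_norm !innerE.
rewrite (innerC g e) (innerC f e) (innerC h e) (innerC h f) (innerC v e).
rewrite (innerC Du e) (innerC q e); lra.
Qed.

(** * Bounding the penalty term by the Fitzpatrick function *)

Section Penalty.
Variables (B : H -> H) (lam beta : nat -> R) (u q : H).
Hypothesis lam_beta : forall n, (1 <= n)%N -> 0 < lam n /\ 0 < beta n.
Let M := zer (op_single B).
Hypothesis Mq : normal_cone M u q.

(** A normal vector at [u] attains its support value at [u]. *)
Lemma support_fun_normal (c : R) : 0 < c ->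
  support_fun M (c *: q) = ('[u, c *: q])%:E.
Proof.
move=> c0; case: Mq => Mu qle; apply/le_anti/andP; split.
  apply: ge_ereal_sup => _ [y My <-]; rewrite lee_fin !innerZr ler_pM2l//.
  by have := qle y My; rewrite !innerE (innerC q y) (innerC q u); lra.
by apply: ereal_sup_ubound; exists u.
Qed.

(** Testing the Fitzpatrick supremum at [(y, B y)] and subtracting [<u, q / beta>] leaves exactly
    [<y - u, q / beta> - <y - u, B y>]. The choice [y = u], where [B u = 0], shows that the terms of
    the series are nonnegative. *)
Lemma penalty_bound :
  (\sum_(1 <= n <oo) ((lam n * beta n)%:E *
     (ereal_sup [set fitzpatrick (op_single B) y ((beta n)^-1 *: q) | y in M]
      - support_fun M ((beta n)^-1 *: q))) < +oo)%E ->
  exists eps : nat -> R, [/\ forall n, 0 <= eps n, bounded_sums 1 eps &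
    forall n y, (1 <= n)%N ->
      lam n * beta n * ('[y - u, (beta n)^-1 *: q] - '[y - u, B y]) <= eps n].
Proof.
pose v n := ((lam n * beta n)%:E *
  (ereal_sup [set fitzpatrick (op_single B) y ((beta n)^-1 *: q) | y in M]
   - support_fun M ((beta n)^-1 *: q)))%E.
rewrite -[X in (X < _)%E]/(\sum_(1 <= n <oo) v n)%E => vlty.
case: (Mq) => Mu _.
have Bu : B u = 0 by [].
have vge n y : (1 <= n)%N ->
    ((lam n * beta n * ('[y - u, (beta n)^-1 *: q] - '[y - u, B y]))%:E <= v n)%E.
  move=> n1; have [lam0 beta0] := lam_beta n1.
  rewrite /v EFinM lee_pmul2l ?fin_numE// ?lte_fin ?mulr_gt0//.
  rewrite support_fun_normal ?invr_gt0// leeBrDr//.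
  apply: (@le_trans _ _ (fitzpatrick (op_single B) u ((beta n)^-1 *: q))).
    apply: ereal_sup_ubound; exists (y, B y) => //=.
    by congr EFin; rewrite !innerE; lra.
  by apply: ereal_sup_ubound; exists u.
have v0 n : (1 <= n)%N -> (0 <= v n)%E.
  by move=> n1; apply: le_trans (vge n u n1); rewrite subrr !inner0l subrr mulr0.
have [vfin vb] := nneseries_bounded_sums v0 vlty.
(* The absolute value ensures a sign at index 0; from index 1 on it changes nothing. *)
exists (fun n => `|fine (v n)|); split=> //.
  apply: (@bounded_sums_le _ _ _ 1 _ _ _ vb) => k k1.
  by rewrite ger0_norm// fine_ge0// v0.
move=> n y n1; apply: le_trans (ler_norm _).
by rewrite -lee_fin fineK ?vfin// vge.
Qed.

End Penalty.

(** * Asymptotics of the iteration *)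

Section Iteration.
Variables (A : H -> set H) (D B : H -> H) (eta mu : R).
Variables (lambda beta alpha : nat -> R) (x p : nat -> H).
Variables (n0 : nat) (a s : R).
Let M := zer (op_single B).
Hypotheses (eta0 : 0 < eta) (mu0 : 0 < mu).
Hypotheses (lipD : (eta^-1).-lipschitz D) (lipB : (mu^-1).-lipschitz B).
Hypothesis monD : monotone_op (op_single D).
Hypothesis pos : forall n, (1 <= n)%N -> [/\ 0 < lambda n, 0 < beta n & 0 < alpha n].
Hypothesis pE : forall n, (1 <= n)%N ->
  resolvent (op_scale (lambda n) A)
    (x n - lambda n *: D (x n) - (lambda n * beta n) *: B (x n)
      + alpha n *: (x n - x n.-1)) (p n).
Hypothesis xE : forall n, (1 <= n)%N ->
  x n.+1 = (lambda n * beta n) *: (B (x n) - B (p n))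
         + lambda n *: (D (x n) - D (p n)) + p n.
Hypothesis penalty : forall u, ran (normal_cone M) u ->
  (\sum_(1 <= n <oo) ((lambda n * beta n)%:E *
     (ereal_sup [set fitzpatrick (op_single B) y ((beta n)^-1 *: u) | y in M]
      - support_fun M ((beta n)^-1 *: u))) < +oo)%E.
Hypotheses (n0_gt0 : (1 <= n0)%N) (a0 : 0 <= a) (s0 : 0 < s).
Hypothesis alpha_incr :
  forall m n, (1 <= m)%N -> (m <= n)%N -> alpha m <= alpha n.
Hypothesis params : forall n, (n0 <= n)%N ->
  0 <= alpha n <= a /\
  5 * a + 2 * s + (1 + 4 * a + 2 * s) *
    (lambda n * beta n / mu + lambda n / eta) ^+ 2 <= 1.

Let d n := `|x n - x n.-1| ^+ 2.
Let e n := `|x n - p n| ^+ 2.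
Let L n := lambda n * beta n / mu + lambda n / eta.

Lemma tseng_correction n : (1 <= n)%N ->
  `|x n.+1 - p n| ^+ 2 <= L n ^+ 2 * e n.
Proof.
move=> n1; have [lam0 beta0 _] := pos n1.
have L0 : 0 <= L n by rewrite addr_ge0 ?divr_ge0 ?mulr_ge0 ?ltW.
rewrite -exprMn lerXn2r ?nnegrE ?mulr_ge0// xE// addrK.
apply: (le_trans (ler_normD _ _)); rewrite !normrZ.
rewrite !ger0_norm ?mulr_ge0 ?(ltW lam0) ?(ltW beta0)// /L mulrDl.
apply: lerD; rewrite -[leRHS]mulrA ler_wpM2l ?mulr_ge0 ?(ltW lam0) ?(ltW beta0)//.
  exact: (@lipB (x n, p n) (conj I I)).
exact: (@lipD (x n, p n) (conj I I)).
Qed.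

(** The parameter condition gives [1 - a - L^2 >= (4 a + 2 s) (1 + L^2)], while
    [d n.+1 <= 2 (1 + L^2) e n]. Hence the negative multiple of [e n] in [tseng_inequality] covers
    both [(2 a + s / 2) d n.+1] and [s * e n]. *)
Lemma tseng_step (gamma : R) (u v q : H) (eps : nat -> R) n :
  strongly_monotone gamma A -> A u v -> (n0 <= n)%N ->
  lambda n * beta n * ('[p n - u, (beta n)^-1 *: q] - '[p n - u, B (p n)])
    <= eps n ->
  `|x n.+1 - u| ^+ 2 - `|x n - u| ^+ 2 <=
    alpha n * (`|x n - u| ^+ 2 - `|x n.-1 - u| ^+ 2) + 2 * alpha n * d n
    - (2 * a + s / 2) * d n.+1 - s * e n
    + (2 * eps n - 2 * (lambda n * '[v + D u + q, p n - u])
       - 2 * (lambda n * (gamma * `|p n - u| ^+ 2))).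
Proof.
move=> smA Auv n0n eps_ge; have n1 := leq_trans n0_gt0 n0n.
have [lam0 beta0 al0] := pos n1.
have [/andP[_ al_a] par] := params n0n.
have resA : lambda n * (gamma * `|p n - u| ^+ 2) <=
    '[p n - u, (x n - p n) - (x n.+1 - p n) + alpha n *: (x n - x n.-1)
      - lambda n *: D (p n) - (lambda n * beta n) *: B (p n) - lambda n *: v].
  have [w -> [_ [b Ab <-] pE']] := pE n1.
  have -> : (x n - p n) - (x n.+1 - p n) + alpha n *: (x n - x n.-1)
      - lambda n *: D (p n) - (lambda n * beta n) *: B (p n) - lambda n *: v =
      lambda n *: (b - v).
    rewrite [RHS]scalerBr; congr (_ - _).
    apply: (addrI (p n)); rewrite pE' xE// addrK.
    (* Pairing with an arbitrary [y] turns the vector identity into one that [ring] decides. *)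
    by apply: inner_ext => y; rewrite !innerE; ring.
  by rewrite innerZr ler_wpM2l ?(ltW lam0)//; exact: smA Ab Auv.
have monDu : 0 <= '[p n - u, D (p n) - D u] by exact: monD.
have := tseng_inequality q lam0 beta0 (ltW al0) resA monDu (tseng_correction n1).
have -> : p n - u + (x n.+1 - p n) = x n.+1 - u by rewrite addrC subrKA.
have -> : p n - u + (x n - p n) = x n - u by rewrite addrC subrKA.
have -> : x n - u - (x n - x n.-1) = x n.-1 - u.
  by rewrite opprB addrC -addrA addKr.
have d_le : d n.+1 <= 2 * (1 + L n ^+ 2) * e n.
  have := tseng_correction n1; rewrite /d /= /e.
  have := inner_ge0 ((x n.+1 - p n) + (x n - p n)).
  have -> : x n.+1 - x n = (x n.+1 - p n) - (x n - p n) by rewrite opprB subrKA.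
  by rewrite -!inner_norm; rewrite !(innerDl _ (- (x n - p n)))
    !(innerDr _ (- (x n - p n))) !innerE; lra.
have e_ge0 : 0 <= e n by exact: sqr_ge0.
have L2_ge0 : 0 <= L n ^+ 2 by exact: sqr_ge0.
have par' : (4 * a + 2 * s) * (1 + L n ^+ 2) <= 1 - a - L n ^+ 2.
  by move: par; rewrite -/(L n); lra.
have h1 := ler_wpM2r e_ge0 par'.
have h2 : (2 * a + s / 2) * d n.+1 <= (2 * a + s / 2) * (2 * (1 + L n ^+ 2) * e n).
  by apply: ler_wpM2l d_le; move: a0 s0; lra.
have h3 := ler_wpM2r e_ge0 al_a.
have h4 := mulr_ge0 (ltW s0) (mulr_ge0 L2_ge0 e_ge0).
rewrite -/(d n) -/(e n); lra.
Qed.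

Hypothesis monA : monotone_op A.
Let ADN := op_add (op_add A (op_single D)) (normal_cone M).

Let strongA0 : strongly_monotone 0 A.
Proof. by move=> y v y' v' Ayv Ayv'; rewrite mul0r; exact: monA. Qed.

Let alpha_bound n : (n0 <= n)%N -> 0 <= alpha n <= a.
Proof. by move=> /params[]. Qed.

Let alpha_incrS n : (n0 <= n)%N -> alpha n <= alpha n.+1.
Proof. by move=> n0n; apply: alpha_incr => //; exact: leq_trans n0n. Qed.

Let a1 : a < 1.
Proof.
have [_ par] := params (leqnn n0).
have := mulr_ge0 (_ : 0 <= 1 + 4 * a + 2 * s) (sqr_ge0 (L n0)).
move: a0 s0 par; rewrite -/(L n0) => a0' s0' par /(_ ltac:(lra)); lra.
Qed.

Let phi0 (u : H) n : 0 <= `|x n - u| ^+ 2.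
Proof. exact: sqr_ge0. Qed.

Let d0 n : 0 <= d n.
Proof. exact: sqr_ge0. Qed.

Let e0 n : 0 <= e n.
Proof. exact: sqr_ge0. Qed.

Let lam_beta n : (1 <= n)%N -> 0 < lambda n /\ 0 < beta n.
Proof. by move=> /pos[]. Qed.

Let lambda0 n : (1 <= n)%N -> 0 <= lambda n.
Proof. by move=> /pos[/ltW]. Qed.

Lemma tseng_zero_step u : zer ADN u ->
  exists b : nat -> R, [/\ forall n, 0 <= b n, bounded_sums n0 b &
  forall n, (n0 <= n)%N ->
  `|x n.+1 - u| ^+ 2 - `|x n - u| ^+ 2 <=
    alpha n * (`|x n - u| ^+ 2 - `|x n.-1 - u| ^+ 2) + 2 * alpha n * d n
    - (2 * a + s / 2) * d n.+1 - s * e n + b n].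
Proof.
move=> [_ [v Auv [_ -> <-]] [q Nuq vDq]].
have [eps [eps0 epsb eps_ge]] := penalty_bound lam_beta Nuq (penalty (ex_intro _ u Nuq)).
exists (fun n => 2 * eps n); split=> [n||n n0n].
- by rewrite mulr_ge0.
- apply: bounded_sumsZ => //.
  exact: (@bounded_sums_le _ 1 n0 0 _ _ _ epsb).
- have := tseng_step strongA0 Auv n0n (eps_ge n (p n) (leq_trans n0_gt0 n0n)).
  by rewrite vDq inner0l mul0r !mulr0 !subr0.
Qed.

Lemma tseng_summable (m : nat) : zer ADN !=set0 ->
  bounded_sums m d /\ bounded_sums m e.
Proof.
move=> [u /tseng_zero_step[b [_ bb step]]].
exact: (inertial_summable alpha_bound alpha_incrS a1 s0 (phi0 u) d0 e0 step).
Qed.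

Lemma tseng_bounded u : zer ADN !=set0 -> exists K, forall n, `|x n - u| <= K.
Proof.
move=> [w /tseng_zero_step[b [_ bb step]]].
have [K phiK] := inertial_bounded alpha_bound alpha_incrS a1 s0 (phi0 w) d0 e0 step bb.
exists (1 + K + `|w - u|) => n.
rewrite -(subrKA w) (le_trans (ler_normD _ _))// lerD2r.
(* From [t^2 <= K] to [t <= 1 + K] through [(t - 1)^2 >= 0], without square roots. *)
by have := phiK n; have := sqr_ge0 (`|x n - w| - 1); rewrite sqrrB1; nra.
Qed.

Lemma tseng_diff_cvg0 : zer ADN !=set0 -> (fun n => x n - x n.-1) @ \oo --> 0.
Proof.
move=> /(tseng_summable 0)[db _]; apply: cvg0_sqr_norm.
exact: bounded_sums_cvg0 db.
Qed.

Lemma tseng_sub_cvg0 : zer ADN !=set0 -> (fun n => x n - p n) @ \oo --> 0.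
Proof.
move=> /(tseng_summable 0)[_ eb]; apply: cvg0_sqr_norm.
exact: bounded_sums_cvg0 eb.
Qed.

Lemma tseng_dist_cvg u : zer ADN u -> cvgn (fun n => `|x n - u| ^+ 2).
Proof.
move=> zu; have zne : zer ADN !=set0 by exists u.
have [b [b0 bb step]] := tseng_zero_step zu.
apply: (inertial_cvg alpha_bound alpha_incrS a1 s0 (phi0 u) d0 e0 step b0 bb).
have [K xK] := tseng_bounded u zne.
have bound n : `| `|x n - u| ^+ 2 - `|x n.-1 - u| ^+ 2| <= 2 * K * `|x n - x n.-1|.
  rewrite -!inner_norm.
  have -> : '[x n - u, x n - u] - '[x n.-1 - u, x n.-1 - u] =
      '[x n - x n.-1, (x n - u) + (x n.-1 - u)].
    rewrite !innerE (innerC (x n.-1) (x n)) (innerC u (x n)) (innerC u (x n.-1)).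
    ring.
  rewrite (le_trans (norm_inner_le _ _))// mulrC ler_wpM2r//.
  by rewrite (le_trans (ler_normD _ _))//; have := xK n; have := xK n.-1; lra.
have lim : (fun n => 2 * K * `|x n - x n.-1|) @ \oo --> 0.
  rewrite -[X in _ --> X](mulr0 (2 * K)) -(@normr0 _ H).
  by apply: cvgM; [exact: cvg_cst|apply: cvg_norm; exact: tseng_diff_cvg0].
apply/cvgr0Pnorm_le => r r0; have /cvgr0Pnorm_le /(_ _ r0) := lim.
apply: filterS => n; apply: le_trans.
by rewrite (le_trans (bound n))// ler_norm.
Qed.

(* gamma = 0 covers a merely monotone A. *)
Lemma tseng_drift (gamma : R) (u v q : H) : zer ADN !=set0 ->
  strongly_monotone gamma A -> A u v -> normal_cone M u q ->
  bounded_sums 1 (fun k => lambda k *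
    ('[v + D u + q, p k - u] + gamma * `|p k - u| ^+ 2)).
Proof.
move=> zne smA Auv Nuq.
have [eps [eps0 epsb eps_ge]] := penalty_bound lam_beta Nuq (penalty (ex_intro _ u Nuq)).
have step n (n0n : (n0 <= n)%N) :=
  tseng_step smA Auv n0n (eps_ge n (p n) (leq_trans n0_gt0 n0n)).
have [K xK] := tseng_bounded u zne.
have phiK n : `|x n - u| ^+ 2 <= K ^+ 2.
  by rewrite lerXn2r ?nnegrE// (le_trans _ (xK n)).
have drift := inertial_drift alpha_bound alpha_incrS s0 (phi0 u) d0 e0 step phiK.
have epsb' : bounded_sums n0 eps by exact: (@bounded_sums_le _ 1 n0 0 _ _ _ epsb).
have half0 : 0 <= 2^-1 :> R by lra.
(* The summand is exactly [eps k] plus half of the negated error term. *)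
apply: (@bounded_sums_le _ n0 1 0 _ _ _ (bounded_sumsD epsb' (bounded_sumsZ half0 drift))).
move=> k _; lra.
Qed.

Hypothesis lam_unb : ~ bounded_sums 1 lambda.
Hypothesis zne : zer ADN !=set0.

(** It suffices that [<u - w, W> >= 0] for each [W = v + q + D u]. The drift bounds the weighted
    sums of [<W, p k - u>]; division by the divergent weight carries the sign to cluster points of
    the means. *)
Lemma tseng_mean_cluster w :
  maximally_monotone (op_add A (normal_cone M)) ->
  weak_cluster \oo (ergodic_mean lambda x) w -> zer ADN w.
Proof.
move=> maxT wz.
have eta0' : 0 < eta^-1 by rewrite invr_gt0.
suff [v Awv [q Nwq vq]] : op_add A (normal_cone M) w (- D w).
  exists (v + D w); first by exists v => //; exists (D w).
  by exists q => //; rewrite addrAC vq addNr.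
apply: (lipschitz_perturbation_zero maxT eta0' lipD) => u _ [v Auv [q Nuq <-]].
set W := v + q + D u.
have drift : bounded_sums 1 (fun k => lambda k * '[W, p k - u]).
  have := tseng_drift zne strongA0 Auv Nuq; apply: (@bounded_sums_le _ 1 1 0).
  by move=> k _; rewrite mul0r addr0 /W addrAC.
clearbody W.
suff : '[w, W] <= '[u, W] by rewrite !innerE (innerC u W) (innerC w W); lra.
apply/ler_addgt0Pr => r r0; have r2 : 0 < r / 2 by rewrite divr_gt0.
(* One [r / 2] pays for replacing [p k] by [x k], the other for the bounded sum divided by the
   weight. *)
have -> : '[u, W] + r = '[u, W] + r / 2 + r / 2 by lra.
apply: wz; under eq_near do rewrite inner_ergodic_mean.
apply: weighted_mean_le => //.
have [K xpK] : exists K, forall k, (K <= k)%N -> '[x k - p k, W] <= r / 2.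
  have : (fun n => `|x n - p n| * `|W|) @ \oo --> 0.
    rewrite -[X in _ --> X](mul0r `|W|) -(@normr0 _ H).
    by apply: cvgM; [apply: cvg_norm; exact: tseng_sub_cvg0|exact: cvg_cst].
  move=> /cvgr0Pnorm_le /(_ _ r2)[K _ xpK]; exists K => k /xpK.
  by apply: le_trans; rewrite (le_trans (inner_le _ _))// ler_norm.
apply: (@bounded_sums_le _ 1 1 K.+1 _ _ _ drift) => k Kk.
rewrite ler_wpM2l ?lambda0 ?(leq_trans _ Kk)//.
by have := xpK k (ltnW Kk); rewrite !innerE (innerC W (p k)) (innerC W u); lra.
Qed.

Lemma tseng_mean_weak_cvg : maximally_monotone (op_add A (normal_cone M)) ->
  exists2 w, zer ADN w & weak_cvg (ergodic_mean lambda x) w.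
Proof.
move=> maxT.
have [K xK] := tseng_bounded 0 zne.
have zK n : `|ergodic_mean lambda x n| <= K.
  by apply: norm_ergodic_mean_le => // k; have := xK k; rewrite subr0.
have [b c zb zc|w wz wcvg] := bounded_weak_cvg zK; last first.
  by exists w => //; exact: tseng_mean_cluster.
have /cvg_ex[/= lb xb] := tseng_dist_cvg (tseng_mean_cluster maxT zb).
have /cvg_ex[/= lc xc] := tseng_dist_cvg (tseng_mean_cluster maxT zc).
(* Opial's argument: two cluster points are zeros, so both distances converge and, by polarisation,
   so does [<x n, b - c>]. Its weighted means then have a single limit, shared by [<b, b - c>] and
   [<c, b - c>]. *)
have : (fun n => '[x n, b - c]) @ \oo --> 2^-1 * (lc - lb - ('[c, c] - '[b, b])).
  have -> : (fun n => '[x n, b - c]) = fun n =>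
      2^-1 * (`|x n - c| ^+ 2 - `|x n - b| ^+ 2 - ('[c, c] - '[b, b])).
    apply/funext => n; rewrite -!inner_norm !innerE (innerC b (x n)) (innerC c (x n)).
    by field.
  apply: cvgM; first exact: cvg_cst.
  by apply: cvgB; [exact: cvgB|exact: cvg_cst].
move=> /(weighted_mean_cvg lambda0 lam_unb); set l := (X in _ --> X) => lP.
have zl : (fun n => '[ergodic_mean lambda x n, b - c]) @ \oo --> l.
  by under eq_fun do rewrite inner_ergodic_mean.
apply/eqP; rewrite -subr_eq0 -normr_eq0 -sqrf_eq0 -inner_norm innerDl innerNl.
by rewrite (weak_cluster_cvg zb zl) (weak_cluster_cvg zc zl) subrr.
Qed.

(** At a zero the linear drift term vanishes, so [lambda k * |p k - u|^2] has bounded sums. A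
    positive limit of [|x n - u|^2] would keep [|p k - u|^2] away from 0 and bound the sums of
    [lambda]. *)
Lemma tseng_strong_cvg (gamma : R) u : 0 < gamma -> strongly_monotone gamma A ->
  zer ADN u -> x @ \oo --> u.
Proof.
move=> gamma0 smA zu; have /cvg_ex[/= l xl] := tseng_dist_cvg zu.
have l0 : 0 <= l by apply: (cvgr_to_ge xl); apply: nearW => n; exact: phi0.
have [l_eq0|l_neq0] := eqVneq l 0.
  have xu : (fun n => x n - u) @ \oo --> 0.
    by apply: cvg0_sqr_norm; rewrite l_eq0 in xl.
  have -> : x = fun n => x n - u + u by apply/funext => n; rewrite subrK.
  by rewrite -[X in _ --> X](add0r u); apply: cvgD => //; exact: cvg_cst.
have l_gt0 : 0 < l by rewrite lt0r l_neq0.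
exfalso; apply: lam_unb.
have [_ [v Auv [_ -> <-]] [q Nuq vDq]] := zu.
have := tseng_drift zne smA Auv Nuq.
have gl : 0 <= 8 / (gamma * l) by rewrite divr_ge0// mulr_ge0 ?ltW.
move=> /(bounded_sumsZ gl).
have [_ eb] := tseng_summable 0 zne.
have e_cvg0 := bounded_sums_cvg0 e0 eb.
(* [|x - u|^2 <= 2 |p - u|^2 + 2 |x - p|^2] with left side at least [l / 2] and
   [|x - p|^2 <= l / 8]. *)
have [n1 n1P] : exists n1, forall n, (n1 <= n)%N -> l / 8 <= `|p n - u| ^+ 2.
  have l8 : 0 < l / 8 by rewrite divr_gt0.
  have l2 : l / 2 < l by lra.
  have e_le : \forall n \near \oo, e n <= l / 8 by exact: cvgr_le e_cvg0 _ l8.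
  have x_ge : \forall n \near \oo, l / 2 <= `|x n - u| ^+ 2.
    exact: cvgr_ge xl _ l2.
  have [n1 _ n1P] := filterI x_ge e_le.
  exists n1 => n /n1P[] /=; rewrite /e.
  have := inner_ge0 ((p n - u) - (x n - p n)).
  have -> : x n - u = (p n - u) + (x n - p n) by rewrite [RHS]addrC subrKA.
  rewrite -!inner_norm; move: (p n - u) (x n - p n) => y y'.
  by rewrite !innerE (innerC y' y); lra.
apply: (@bounded_sums_le _ 1 1 n1.+1) => k n1k.
rewrite vDq inner0l add0r.
rewrite (_ : 8 / _ * _ = lambda k * (`|p k - u| ^+ 2 / (l / 8))); last first.
  by field; rewrite ?gt_eqF.
rewrite -[leLHS]mulr1 ler_wpM2l ?lambda0 ?(leq_trans _ n1k)//.
by rewrite ler_pdivlMr ?divr_gt0// mul1r n1P// ltnW.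
Qed.

End Iteration.

End PenalizedTseng.

Theorem theorem10 (R : realType) (H : hilbertType R)
  (A : H -> set H) (D B : H -> H) (eta mu : R)
  (lambda beta alpha : nat -> R) (x p : nat -> H) :
  let M := zer (op_single B) in
  let ADN := op_add (op_add A (op_single D)) (normal_cone M) in
  let z := ergodic_mean lambda x in
  maximally_monotone A ->
  0 < eta -> monotone_op (op_single D) -> (eta^-1).-lipschitz D ->
  0 < mu -> monotone_op (op_single B) -> (mu^-1).-lipschitz B ->
  M !=set0 ->
  (forall n, (1 <= n)%N -> [/\ 0 < lambda n, 0 < beta n & 0 < alpha n]) ->
  (forall n, (1 <= n)%N ->
    resolvent (op_scale (lambda n) A)
      (x n - lambda n *: D (x n) - (lambda n * beta n) *: B (x n)
        + alpha n *: (x n - x n.-1)) (p n)) ->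
  (forall n, (1 <= n)%N ->
    x n.+1 = (lambda n * beta n) *: (B (x n) - B (p n))
           + lambda n *: (D (x n) - D (p n)) + p n) ->
  maximally_monotone (op_add A (normal_cone M)) ->
  zer ADN !=set0 ->
  (forall u, ran (normal_cone M) u ->
    (\sum_(1 <= n <oo) ((lambda n * beta n)%:E *
       (ereal_sup [set fitzpatrick (op_single B) y ((beta n)^-1 *: u) | y in M]
        - support_fun M ((beta n)^-1 *: u))) < +oo)%E) ->
  in_ell 2 lambda -> ~ in_ell 1 lambda ->
  (forall m n, (1 <= m)%N -> (m <= n)%N -> alpha m <= alpha n) ->
  (exists (n0 : nat) (a s : R), [/\ (1 <= n0)%N, 0 <= a, 0 < s &
    forall n, (n0 <= n)%N ->
      0 <= alpha n <= a /\
      5 * a + 2 * s + (1 + 4 * a + 2 * s) *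
        (lambda n * beta n / mu + lambda n / eta) ^+ 2 <= 1]) ->
  [/\
    (\sum_(0 <= n <oo) (`|x n.+1 - x n| ^+ 2)%:E < +oo)%E /\
    (\sum_(1 <= n <oo) (`|x n - p n| ^+ 2)%:E < +oo)%E,
    exists2 w, zer ADN w & weak_cvg z w &
    forall gamma : R, 0 < gamma -> strongly_monotone gamma A ->
      exists w, [/\ zer ADN = [set w], x @ \oo --> w & p @ \oo --> w]].

Proof.
move=> M ADN z [monA maxA] eta0 monD lipD mu0 monB lipB M0 pos pE xE maxT zne
  penalty lam_ell2 lam_nell1 alpha_incr [n0 [a [s [n0_gt0 a0 s0 params]]]].
(* For positive [lambda], absence from [l^1] means unbounded partial sums. *)
have lam_unb : ~ bounded_sums 1 lambda.
  move=> lam_b; apply: lam_nell1; apply: bounded_sums_nneseries.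
    by move=> n; rewrite expr1.
  apply: (@bounded_sums_le _ 1 1 1 _ _ _ lam_b) => k /pos[lam0 _ _].
  by rewrite expr1 ger0_norm// ltW.
have summable (m : nat) := tseng_summable eta0 mu0 lipD lipB monD pos pE xE penalty
  n0_gt0 a0 s0 alpha_incr params monA m zne.
have strong := tseng_strong_cvg eta0 mu0 lipD lipB monD pos pE xE penalty
  n0_gt0 a0 s0 alpha_incr params monA lam_unb zne.
have xp := tseng_sub_cvg0 eta0 mu0 lipD lipB monD pos pE xE penalty
  n0_gt0 a0 s0 alpha_incr params monA zne.
split.
- split.
    apply: bounded_sums_nneseries => [n|]; first exact: sqr_ge0.
    have [[C dC] _] := summable 1%N.
    (* [d] looks back one index, so its sum from 1 is the required sum from 0. *)
    by exists C => N; have := dC N.+1; rewrite big_add1.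
  apply: bounded_sums_nneseries => [n|]; first exact: sqr_ge0.
  by have [] := summable 1%N.
- exact: (tseng_mean_weak_cvg eta0 mu0 lipD lipB monD pos pE xE penalty
    n0_gt0 a0 s0 alpha_incr params monA lam_unb zne maxT).
- move=> gamma gamma0 smA; have [w zw] := zne.
  have xw : x @ \oo --> w by exact: strong smA zw.
  exists w; split=> //.
    (* Every zero is a limit of the same sequence [x], hence uniqueness. *)
    apply/seteqP; split=> [u zu|_ -> //].
    by apply: (cvg_unique _ _ xw) => //; exact: strong smA zu.
  have -> : p = fun n => x n - (x n - p n) by apply/funext => n; rewrite subKr.
  by rewrite -[X in _ --> X](subr0 w); exact: cvgB.
Qed.
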